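(* Let $G\sim G(n,p)$ be a random graph on $[n]=\{1,\dots,n\}$, with its natural order. Then: (i) for every $0<\varepsilon<1$, if $p=(1-\varepsilon)\frac{\ln n}{n}$, then w.h.p. there is no monotone path in $G$ from $1$ to $n$; (ii) for every $\varepsilon>0$, if $p=(1+\varepsilon)\frac{\ln n}{n}$, then w.h.p. there is a monotone path in $G$ from $1$ to $n$.
   Context: $G(n,p)$ is the random graph on $[n]$ in which each pair is an edge independently with probability $p$. A path $P=(v_0,\ldots,v_t)$ in $G$ is monotone if $v_0<v_1<\cdots<v_t$. ''W.h.p.'' means with probability tending to $1$ as $n\to\infty$ (with $\varepsilon$ fixed). *)

(* Defs.v *)
From HB Require Import structures.
From mathcomp Require Import all_boot all_order all_algebra.
From mathcomp Require Import all_classical all_reals all_analysis.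

Set Implicit Arguments.
Unset Strict Implicit.
Unset Printing Implicit Defensive.

Import Order.TTheory GRing.Theory Num.Theory.
Import numFieldNormedType.Exports.

Local Open Scope classical_set_scope.
Local Open Scope ring_scope.

(* The element k of 'I_n stands for the vertex k + 1 of [n] = {1, ..., n}. *)
Definition vpair (n : nat) : finType := {e : {set 'I_n} | #|e| == 2%N}.

(* A simple graph on [n], as its set of edges. *)
Definition graph (n : nat) : finType := {set vpair n}.

Definition adj (n : nat) (G : graph n) : rel 'I_n :=
  fun u v => [exists e in G, val e == [set u; v]%SET].

(* The path is (x, s_0, s_1, ...), possibly of length 0. Its vertices are
   distinct because they increase. *)
Definition monotone_path (n : nat) (G : graph n) (x : 'I_n) (s : seq 'I_n)
    : bool :=
  path (adj G) x s && path (fun u v : 'I_n => (u < v)%N) x s.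

Definition has_monotone_path (n : nat) (G : graph n) : Prop :=
  exists (x : 'I_n) (s : seq 'I_n),
    [/\ val x = 0%N, val (last x s) = n.-1 & monotone_path G x s].

Definition gnp_weight (R : realType) (n : nat) (p : R) (G : graph n) : R :=
  \prod_(e : vpair n) (if e \in G then p else 1 - p).

(* The probability that G(n,p) lies in A, meaningful for 0 <= p <= 1. Outside
   this range it is a formal expression; for p = c * ln n / n with fixed c >= 0
   this concerns finitely many n only, hence does not affect limits. *)
Definition gnp_prob (R : realType) (n : nat) (p : R) (A : set (graph n)) : R :=
  \sum_(G : graph n | `[< A G >]) gnp_weight p G.

Lemma gnp_weight_ge0 (R : realType) (n : nat) (p : R) (G : graph n) :
  0 <= p <= 1 -> 0 <= gnp_weight p G.
Proof.
move=> /andP[p0 p1]; apply: prodr_ge0 => e _.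
by case: ifP => // _; rewrite subr_ge0.
Qed.

Lemma gnp_probT (R : realType) (n : nat) (p : R) :
  gnp_prob p [set: graph n] = 1.
Proof.
rewrite /gnp_prob (eq_bigl predT); last by move=> G; apply/asboolP.
rewrite /gnp_weight -(bigA_distr _ _ (fun=> p) (fun=> 1 - p)).
by rewrite big1 // => e _; rewrite /= addrC subrK.
Qed.

Definition whp (R : realType) (p : nat -> R) (A : forall n, set (graph n))
    : Prop :=
  gnp_prob (p n) (A n) @[n --> \oo] --> (1 : R).

(* Main.v *)
Require Import Defs.
From HB Require Import structures.
From mathcomp Require Import all_boot all_order all_algebra.
From mathcomp Require Import all_classical all_reals all_analysis.
From mathcomp Require Import ring lra.

Set Implicit Arguments.
Unset Strict Implicit.
Unset Printing Implicit Defensive.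

Import Order.TTheory GRing.Theory Num.Theory.
Import numFieldNormedType.Exports.

Local Open Scope classical_set_scope.
Local Open Scope ring_scope.

(** Reveal the vertices in increasing order. Let X_m be the number of vertices
    among 0, ..., m that are the end of a monotone path from 0. The edges from
    vertex m + 1 to smaller vertices are independent of all that determines X_m,
    and m + 1 is reachable unless none of its X_m potential edges to reachable
    vertices is present. With q = 1 - p, the sequence X_m is therefore a pure
    birth chain that starts at 1 and moves up with probability 1 - q ^ X_m
    ([gnp_exp_card_reachS]), and on n = m + 2 vertices the probability that no
    monotone path joins the first vertex to the last is E [q ^ X_m]
    ([gnp_prob_no_path]).

    Below the threshold, 1 - q ^ x <= p x shows that E [X_m] grows by a factor of
    at most 1 + p per step, so a path exists with probability at most
    p (1 + p) ^ m ([gnp_prob_path_le]). For p = (1 - eps) ln n / n this is at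
    most ln n * n ^ (- eps).

    Above the threshold, one needs that X_m grows fast with high probability and
    not only on average. The variable y = q ^ X_m performs a random discretisation
    of the logistic equation y' = - p y (1 - y), along which y / (1 - y) decays
    like exp (- p t). The random jumps cost a factor of about 2 in this rate when X_m = 1;
    moving the pole of y / (1 - y) close to the starting point y = q gives a
    function whose expectation decays at the rate p / (1 + b), for any b > 0, at
    the price of an initial value 1 / (b p) ([potential_step],
    [gnp_exp_potential_le]). This function dominates y, so no path exists with
    probability at most (1 - p / (1 + b)) ^ m / (b p) ([gnp_prob_no_path_le]).
    For p = (1 + eps) ln n / n and b = eps the power is of order 1 / n, and the
    prefactor is n / (eps (1 + eps) ln n): the product is O (1 / ln n). *)

(** * Vertices reachable by monotone paths *)

Definition vedge (n : nat) (u v : 'I_n) (uv : u != v) : vpair n.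
Proof. by exists [set u; v]%SET; rewrite cards2 uv. Defined.

Lemma adjE (n : nat) (G : graph n) (u v : 'I_n) (uv : u != v) :
  adj G u v = (vedge uv \in G).
Proof.
apply/existsP/idP => [[e /andP[eG /eqP e_uv]]|eG]; last first.
  by exists (vedge uv); rewrite eG /=.
by suff -> : vedge uv = e by []; apply: val_inj; rewrite e_uv.
Qed.

Lemma adj_setU1 (n : nat) (G : graph n) (e : vpair n) (u v : 'I_n) :
  val e != [set u; v]%SET -> adj (e |: G)%SET u v = adj G u v.
Proof.
move=> e_uv; apply: eq_existsb => e'.
rewrite !inE; case: eqP => // ->; by rewrite (negbTE e_uv) !andbF.
Qed.

(** The vertices v <= m that end a monotone path from the least vertex (see
    [reach_path] and [reach_last]). The recursion on m, rather than on paths,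
    makes the step from m to m + 1 depend only on the edges at vertex m + 1. *)
Fixpoint reach (n : nat) (G : graph n) (m : nat) : {set 'I_n} :=
  if m is m'.+1 then
    (reach G m' :|:
      [set v : 'I_n | (val v == m) && [exists u in reach G m', adj G u v]])%SET
  else [set v : 'I_n | val v == 0%N]%SET.

Lemma reach_leq (n : nat) (G : graph n) (m : nat) (v : 'I_n) :
  v \in reach G m -> (v <= m)%N.
Proof.
elim: m => [|m IH] /=; rewrite !inE; first by move/eqP->.
by case/orP => [vm|/andP[/eqP-> //]]; exact/leqW/IH.
Qed.

Lemma reach_homo (n : nat) (G : graph n) (m m' : nat) :
  (m <= m')%N -> reach G m \subset reach G m'.
Proof.
elim: m' => [|m' IH]; first by rewrite leqn0 => /eqP->.
rewrite leq_eqVlt => /predU1P[->//|/IH mm']; apply: fintype.subset_trans mm' _.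
exact: finset.subsetUl.
Qed.

Lemma reach_last (n : nat) (G : graph n) (x : 'I_n) (s : seq 'I_n) :
  val x = 0%N -> monotone_path G x s -> last x s \in reach G (last x s).
Proof.
move=> x0; elim/last_ind: s => [|s y IH]; first by rewrite /= x0 inE x0.
rewrite /monotone_path !rcons_path last_rcons.
move=> /andP[/andP[ps a] /andP[ms l]].
have /IH := introT andP (conj ps ms).
(* The vertex y is added at stage y = k + 1, when its predecessor on the path is
   already present. *)
case yk: (nat_of_ord y) l => [//|k] l /(fintype.subsetP (reach_homo G (l : (_ <= k)%N))) r.
rewrite /= !inE yk eqxx; apply/orP; right; apply/existsP.
by exists (last x s); rewrite r.
Qed.

Lemma reach_path (n : nat) (G : graph n) (m : nat) (v : 'I_n) :
  v \in reach G m ->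
  exists x s, [/\ val x = 0%N, last x s = v & monotone_path G x s].
Proof.
elim: m v => [|m IH] v /=; rewrite !inE; first by move/eqP=> v0; exists v, [::].
case/orP => [/IH//|/andP[/eqP vm /existsP[u /andP[ur a]]]].
have [x [s [x0 lx /andP[ps ms]]]] := IH _ ur.
exists x, (rcons s v); split; rewrite ?last_rcons//.
by rewrite /monotone_path !rcons_path lx ps ms a /= vm ltnS (reach_leq ur).
Qed.

Lemma reachS (n : nat) (G : graph n) (m : nat) (v : 'I_n) : val v = m.+1 ->
  reach G m.+1 =
  if [forall u in reach G m, ~~ adj G u v] then reach G m
  else (v |: reach G m)%SET.
Proof.
move=> vm.
have -> : [forall u in reach G m, ~~ adj G u v] =
   ~~ [exists u in reach G m, adj G u v].
  by rewrite negb_exists; apply: eq_forallb => u; rewrite negb_and implybE.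
apply/finset.setP => w; rewrite /= !inE -vm val_eqE.
case: ifP => [/negbTE E|/negbT/negPn E]; case: eqVneq => [->|wv];
  by rewrite ?E ?orbF ?orbT ?inE ?eqxx ?(negbTE wv).
Qed.

Lemma card_reachS (n : nat) (G : graph n) (m : nat) (v : 'I_n) : val v = m.+1 ->
  #|reach G m.+1| =
  (#|reach G m| + ~~ [forall u in reach G m, ~~ adj G u v])%N.
Proof.
move=> vm; rewrite (reachS G vm).
case: ifP => _; first by rewrite addn0.
rewrite cardsU1 addnC; congr (_ + nat_of_bool _)%N.
by apply: contraT => /negPn/reach_leq; rewrite vm ltnn.
Qed.

(** The source of independence: [reach G m] only looks at edges whose larger end
    is at most m. *)
Lemma reach_setU1 (n : nat) (G : graph n) (m : nat) (u v : 'I_n)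
    (uv : u != v) : (m < v)%N -> reach (vedge uv |: G)%SET m = reach G m.
Proof.
elim: m => [//|m IH] mv; rewrite /= (IH (ltnW mv)).
congr (_ :|: _)%SET; apply/finset.setP => w; rewrite !inE.
have [wm|//] := eqP; apply: eq_existsb => x.
have [xr|//] := boolP (x \in reach G m); rewrite /= adj_setU1//=.
apply/eqP => /finset.setP/(_ v); rewrite !inE eqxx orbT.
move/esym/orP => [/eqP vx|/eqP vw].
  by have := reach_leq xr; rewrite -vx leqNgt (ltnW mv).
by move: mv; rewrite vw wm ltnn.
Qed.

Lemma has_monotone_pathE (n : nat) (G : graph n) (v : 'I_n) (m : nat) :
  n = m.+2 -> val v = m.+1 ->
  has_monotone_path G <-> ~~ [forall u in reach G m, ~~ adj G u v].
Proof.
move=> nm vm.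
have -> : ~~ [forall u in reach G m, ~~ adj G u v] = (v \in reach G m.+1).
  rewrite (reachS G vm); case: ifP => _; rewrite ?inE ?eqxx//.
  by apply/esym/negP => /reach_leq; rewrite vm ltnn.
split=> [[x [s [x0 l P]]]|/reach_path[x [s [x0 l P]]]].
  have <- : last x s = v by apply: val_inj; rewrite /= l vm nm.
  suff -> : m.+1 = last x s by apply: reach_last.
  by rewrite l nm.
by exists x, s; split=> //; rewrite l vm nm.
Qed.

(** * Expectation over G(n,p) *)

Definition gnp_exp (R : realType) (n : nat) (p : R) (f : graph n -> R) : R :=
  \sum_(G : graph n) gnp_weight p G * f G.

Lemma gnp_probE (R : realType) (n : nat) (p : R) (A : set (graph n))
    (b : pred (graph n)) : (forall G, A G <-> b G) ->
  gnp_prob p A = gnp_exp p (fun G => (b G)%:R).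
Proof.
move=> Ab; rewrite /gnp_prob /gnp_exp big_mkcond /=; apply: eq_bigr => G _.
have -> : `[< A G >] = b G by apply/asboolP/idP => /Ab.
by case: (b G); rewrite ?mulr1 ?mulr0.
Qed.

Lemma gnp_exp_le (R : realType) (n : nat) (p : R) (f g : graph n -> R) :
  0 <= p <= 1 -> (forall G, f G <= g G) -> gnp_exp p f <= gnp_exp p g.
Proof.
move=> p01 fg; apply: ler_sum => G _; apply: ler_wpM2l => //.
exact: gnp_weight_ge0.
Qed.

Lemma eq_gnp_exp (R : realType) (n : nat) (p : R) (f g : graph n -> R) :
  f =1 g -> gnp_exp p f = gnp_exp p g.
Proof. by move=> fg; apply: eq_bigr => G _; rewrite fg. Qed.

Lemma gnp_expZ (R : realType) (n : nat) (p c : R) (f : graph n -> R) :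
  gnp_exp p (fun G => c * f G) = c * gnp_exp p f.
Proof. by rewrite /gnp_exp mulr_sumr; apply: eq_bigr => G _; rewrite mulrCA. Qed.

Lemma gnp_expD (R : realType) (n : nat) (p : R) (f g : graph n -> R) :
  gnp_exp p (fun G => f G + g G) = gnp_exp p f + gnp_exp p g.
Proof. by rewrite /gnp_exp -big_split; apply: eq_bigr => G _; rewrite mulrDr. Qed.

Lemma gnp_exp1 (R : realType) (n : nat) (p : R) :
  gnp_exp p (fun _ : graph n => 1) = 1.
Proof.
by rewrite -[RHS](gnp_probT n p) (@gnp_probE _ _ _ _ predT).
Qed.

(** Independence from one edge: G pairs with e |: G, on which f agrees, and the
    weights of the two members are as 1 - p to p. *)
Lemma gnp_exp_nmem (R : realType) (n : nat) (p : R) (e : vpair n)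
    (f : graph n -> R) : (forall G, f (e |: G)%SET = f G) ->
  gnp_exp p (fun G => (e \notin G)%:R * f G) = (1 - p) * gnp_exp p f.
Proof.
move=> fe.
(* The weight of G with the factor of e left out. *)
pose r (G : graph n) : R :=
  \prod_(e' : vpair n | e' != e) (if e' \in G then p else 1 - p).
have wE (G : graph n) : gnp_weight p G = (if e \in G then p else 1 - p) * r G.
  by rewrite /gnp_weight (bigD1 e).
have rE (G : graph n) : r (e |: G)%SET = r G.
  by apply: eq_bigr => e' /negbTE e'e; rewrite !inE e'e.
have -> : gnp_exp p f = \sum_(G : graph n | e \notin G) r G * f G.
  rewrite /gnp_exp (bigID (fun G : graph n => e \in G)) /=.
  rewrite (reindex_onto (fun G : graph n => e |: G)%SET (fun G => G :\ e)%SET) /=;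
    last by move=> G eG; rewrite finset.setD1K.
  rewrite (eq_bigl (fun G : graph n => e \notin G)); last first.
    move=> G; rewrite setU11 /=; apply/eqP/idP => [<-|eG]; first by rewrite !inE eqxx.
    by rewrite setU1K.
  rewrite -big_split /=; apply: eq_bigr => G eG.
  by rewrite !wE fe rE setU11 (negbTE eG); ring.
rewrite mulr_sumr [RHS]big_mkcond; apply: eq_bigr => G _; rewrite wE.
by case: (e \in G); rewrite /= ?mul0r ?mulr0// mul1r mulrA.
Qed.

(** Independence from the edges between v and s, obtained by removing these edges
    one at a time with [gnp_exp_nmem]. *)
Lemma gnp_exp_all_nadj (R : realType) (n : nat) (p : R) (v : 'I_n)
    (s : seq 'I_n) (f : graph n -> R) :
  uniq s -> v \notin s ->
  (forall u (uv : u != v) G, f (vedge uv |: G)%SET = f G) ->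
  gnp_exp p (fun G => (all (fun u => ~~ adj G u v) s)%:R * f G) =
  (1 - p) ^+ size s * gnp_exp p f.
Proof.
elim: s f => [|u s IH] f /=.
  by move=> _ _ _; rewrite expr0 mul1r; apply: eq_gnp_exp => G; rewrite mul1r.
move=> /andP[us ss]; rewrite inE negb_or eq_sym => /andP[uv vs] fv.
rewrite exprS -mulrA -IH// -(@gnp_exp_nmem _ _ _ (vedge uv)).
  by apply: eq_gnp_exp => G; rewrite (adjE _ uv) -mulnb natrM mulrA.
move=> G; rewrite fv; congr (_%:R * _); congr nat_of_bool.
apply: eq_in_all => w ws; rewrite adj_setU1//=.
apply/eqP => /finset.setP/(_ u); rewrite !inE eqxx (negbTE uv) !orbF.
by move/esym/eqP=> uw; rewrite uw ws in us.
Qed.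

(** * The birth chain of reachable vertices *)

(** Given the set reached among 0, ..., m, a later vertex v misses all of it with
    conditional probability (1 - p) to its cardinality. The set is random, so the
    proof splits according to its value S, to which independence applies. *)
Lemma gnp_exp_reach (R : realType) (n : nat) (p : R) (m : nat) (v : 'I_n)
    (h : {set 'I_n} -> R) : (m < v)%N ->
  gnp_exp p (fun G =>
    [forall u in reach G m, ~~ adj G u v]%:R * h (reach G m)) =
  gnp_exp p (fun G => (1 - p) ^+ #|reach G m| * h (reach G m)).
Proof.
move=> mv.
have split_reach (g : graph n -> {set 'I_n} -> R) :
    gnp_exp p (fun G => g G (reach G m)) =
    \sum_(S : {set 'I_n}) gnp_exp p (fun G => g G S * (reach G m == S)%:R).
  rewrite /gnp_exp exchange_big; apply: eq_bigr => G _.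
  rewrite (bigD1 (reach G m))//= eqxx mulr1 big1 ?addr0// => S.
  by rewrite eq_sym => /negbTE->; rewrite !mulr0.
rewrite (split_reach (fun G S => [forall u in S, ~~ adj G u v]%:R * h S)).
rewrite (split_reach (fun G S => (1 - p) ^+ #|S| * h S)).
apply: eq_bigr => S _.
under eq_gnp_exp do rewrite -mulrA.
under [RHS]eq_gnp_exp do rewrite -mulrA.
rewrite gnp_expZ cardE.
(* A set that contains v > m is not a value of reach G m. *)
have [vS|vS] := boolP (v \in S).
  have z (G : graph n) : (reach G m == S) = false.
    by apply/negP => /eqP E; move: vS; rewrite -E => /reach_leq; rewrite leqNgt mv.
  rewrite -[RHS]gnp_expZ.
  by apply: eq_gnp_exp => G; rewrite z !mulr0.
rewrite -(@gnp_exp_all_nadj _ _ _ v) ?enum_uniq ?mem_enum//; last first.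
  by move=> u uv G; rewrite reach_setU1.
apply: eq_gnp_exp => G; congr (_%:R * _); congr nat_of_bool.
apply/forallP/allP => [H u|H u]; first by rewrite mem_enum; apply/implyP.
by apply/implyP => uS; apply: H; rewrite mem_enum.
Qed.

(** The transition rule of the birth chain: from x it stays with probability
    (1 - p) ^ x and otherwise moves to x + 1. *)
Lemma gnp_exp_card_reachS (R : realType) (n : nat) (p : R) (m : nat)
    (phi : nat -> R) : (m.+1 < n)%N ->
  gnp_exp p (fun G : graph n => phi #|reach G m.+1|) =
  gnp_exp p (fun G : graph n => phi #|reach G m|.+1 +
    (1 - p) ^+ #|reach G m| * (phi #|reach G m| - phi #|reach G m|.+1)).
Proof.
move=> mn; pose v := Ordinal mn.
rewrite gnp_expD.
rewrite -(@gnp_exp_reach R n p m v (fun S => phi #|S| - phi #|S|.+1))//.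
rewrite -gnp_expD; apply: eq_gnp_exp => G.
rewrite (@card_reachS _ G m v erefl).
by case: ([forall u in _, _]); rewrite ?addn0 ?addn1 ?mul1r ?mul0r ?addr0// addrC subrK.
Qed.

Lemma card_reach0 (n : nat) (G : graph n) : (0 < n)%N -> #|reach G 0| = 1%N.
Proof.
move=> n0; rewrite -(cards1 (Ordinal n0)); congr #|pred_of_set _|.
by apply/finset.setP => v; rewrite /= !inE -val_eqE.
Qed.

Lemma card_reach_gt0 (n : nat) (G : graph n) (m : nat) :
  (0 < n)%N -> (0 < #|reach G m|)%N.
Proof.
move=> n0; rewrite -(card_reach0 G n0); exact/subset_leq_card/reach_homo.
Qed.

(** There is no path exactly when the last vertex m + 1 has no edge to the
    vertices reached among 0, ..., m. *)
Lemma gnp_prob_no_path (R : realType) (m : nat) (p : R) :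
  gnp_prob p [set G : graph m.+2 | ~ has_monotone_path G] =
  gnp_exp p (fun G : graph m.+2 => (1 - p) ^+ #|reach G m|).
Proof.
have E (G : graph m.+2) :=
  @has_monotone_pathE m.+2 G (@ord_max m.+1) m erefl erefl.
rewrite (@gnp_probE _ _ _ _
  (fun G => [forall u in reach G m, ~~ adj G u ord_max])).
  have := @gnp_exp_reach R _ p m (@ord_max m.+1) (fun=> 1) (ltnSn m).
  by under eq_gnp_exp do rewrite mulr1; under [RHS]eq_gnp_exp do rewrite mulr1.
move=> G /=; rewrite E; case: ([forall u in _, _]); split=> //.
Qed.

Lemma gnp_probC (R : realType) (n : nat) (p : R) (A : set (graph n)) :
  gnp_prob p (~` A) = 1 - gnp_prob p A.
Proof.
apply/eqP; rewrite eq_sym subr_eq; apply/eqP.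
rewrite (@gnp_probE _ _ _ A (fun G => `[< A G >])); last first.
  by move=> G; split => /asboolP.
rewrite (@gnp_probE _ _ _ (~` A) (fun G => ~~ `[< A G >])); last first.
  by move=> G; split => /asboolPn.
rewrite -gnp_expD -[LHS](gnp_exp1 n p).
by apply: eq_gnp_exp => G; case: `[< _ >]; rewrite /= ?addr0 ?add0r.
Qed.

(** * Few paths: the first moment of the chain *)

Lemma bernoulli_ineq (R : realType) (p : R) (k : nat) :
  0 <= p <= 1 -> 1 - p * k%:R <= (1 - p) ^+ k.
Proof.
move=> /andP[p0 p1]; elim: k => [|k IH]; first by rewrite expr0 mulr0 subr0.
rewrite exprS; apply: (@le_trans _ _ ((1 - p) * (1 - p * k%:R))).
  have := mulr_ge0 (mulr_ge0 p0 p0) (ler0n R k).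
  by rewrite -natr1; lra.
by apply: ler_wpM2l => //; rewrite subr_ge0.
Qed.

(** The chain moves up from x with probability at most p x. *)
Lemma gnp_exp_card_reach_le (R : realType) (n : nat) (p : R) (m : nat) :
  0 <= p <= 1 -> (m < n)%N ->
  gnp_exp p (fun G : graph n => #|reach G m|%:R) <= (1 + p) ^+ m.
Proof.
move=> p01; elim: m => [|m IH] mn.
  rewrite expr0 -[leRHS](gnp_exp1 n p); apply: gnp_exp_le => // G.
  by rewrite card_reach0.
rewrite (gnp_exp_card_reachS p (fun k => k%:R) mn) exprS.
apply: (@le_trans _ _ (gnp_exp p (fun G : graph n => (1 + p) * #|reach G m|%:R))).
  apply: gnp_exp_le => // G; have := bernoulli_ineq #|reach G m| p01.
  by rewrite /= -natr1; move: (_ ^+ _) (_%:R) => y x; lra.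
rewrite gnp_expZ; apply: ler_wpM2l; last exact/IH/ltnW.
by case/andP: p01 => p0 _; rewrite addr_ge0.
Qed.

Lemma gnp_prob_path_le (R : realType) (m : nat) (p : R) : 0 <= p <= 1 ->
  gnp_prob p [set G : graph m.+2 | has_monotone_path G] <= p * (1 + p) ^+ m.
Proof.
move=> p01; rewrite -[X in gnp_prob p X]setCK gnp_probC gnp_prob_no_path lerBlDr.
apply: (@le_trans _ _ (gnp_exp p (fun G : graph m.+2 =>
    p * #|reach G m|%:R + (1 - p) ^+ #|reach G m|))).
  rewrite -[leLHS](gnp_exp1 m.+2 p); apply: gnp_exp_le => // G.
  have := bernoulli_ineq #|reach G m| p01.
  by rewrite /=; move: (_ ^+ _) (_%:R) => y x; lra.
rewrite gnp_expD gnp_expZ lerD2r; apply: ler_wpM2l; first by case/andP: p01.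
exact/gnp_exp_card_reach_le/ltnW.
Qed.

(** * Many paths: a decaying potential *)

(** A variant of y / (1 - y), the quantity that decays exponentially along the
    logistic flow. Up to a constant factor it is y / (1 - a y), where
    a (1 - p) = 1 - b p: the pole 1 / a lies just above 1 - p, the value of y at
    the start of the chain. *)
Definition potential (R : realType) (b p y : R) : R :=
  y / (1 - p - (1 - b * p) * y).

(** With q = 1 - p, the drop F y - F (q y) equals F y * p / (1 - (1 - b p) y), and
    it happens with probability 1 - y. Since p y <= p <= 1 - y, the denominator
    1 - y + b p y is at most (1 + b) (1 - y), so the expected drop is at least the
    fraction p / (1 + b) of F y. *)
Lemma potential_step (R : realType) (b p y : R) :
  0 < p < 1 -> 0 < b -> b * p < 1 -> 0 <= y <= 1 - p ->
  potential b p ((1 - p) * y)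
    + y * (potential b p y - potential b p ((1 - p) * y))
  <= (1 - p / (1 + b)) * potential b p y.
Proof.
move=> /andP[p0 p1] b0 bp /andP[y0 yp].
have bp0 : 0 < b * p by rewrite mulr_gt0.
have q0 : 0 < 1 - p by rewrite subr_gt0.
have d0 : 0 < 1 - p - (1 - b * p) * y.
  have : (1 - b * p) * y <= (1 - b * p) * (1 - p) by apply: ler_wpM2l => //; lra.
  by have := mulr_gt0 bp0 q0; lra.
(* d0 and e0 say that the denominators of F y and, once q is cancelled, of F (q y)
   are positive. *)
have e0 : 0 < 1 - (1 - b * p) * y by lra.
have stepE : potential b p ((1 - p) * y) = y / (1 - (1 - b * p) * y).
  rewrite /potential; field; rewrite ?gt_eqF//=.
  by rewrite (_ : _ - _ = (1 - p) * (1 - (1 - b * p) * y)) ?mulr_gt0//; ring.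
rewrite stepE -subr_ge0.
have -> : (1 - p / (1 + b)) * potential b p y -
    (y / (1 - (1 - b * p) * y) + y * (potential b p y - y / (1 - (1 - b * p) * y)))
  = y * p * (b * (1 - y) - b * p * y)
    / ((1 - p - (1 - b * p) * y) * ((1 + b) * (1 - (1 - b * p) * y))).
  by rewrite /potential; field; rewrite !gt_eqF//; lra.
apply: divr_ge0; last by rewrite ltW// !mulr_gt0//; lra.
apply: mulr_ge0; first by rewrite mulr_ge0// ltW.
rewrite -mulrA -mulrBr mulr_ge0 ?(ltW b0)//.
have : p * y <= p * 1 by apply: ler_wpM2l; lra.
lra.
Qed.

Lemma gnp_exp_potential_le (R : realType) (n : nat) (b p : R) (m : nat) :
  0 < p < 1 -> 0 < b -> b * p < 1 -> (m < n)%N ->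
  gnp_exp p (fun G : graph n => potential b p ((1 - p) ^+ #|reach G m|))
  <= (1 - p / (1 + b)) ^+ m / (b * p).
Proof.
move=> p01 b0 bp; have /andP[p0 p1] := p01.
have p01' : 0 <= p <= 1 by rewrite !ltW.
have q0 : 0 < 1 - p by rewrite subr_gt0.
elim: m => [|m IH] mn.
  rewrite expr0 mul1r -[leRHS]mulr1 -[X in _ <= _ * X](gnp_exp1 n p) -gnp_expZ.
  apply: gnp_exp_le => // G; rewrite card_reach0// expr1 mulr1 /potential.
  rewrite le_eqVlt; apply/orP; left; apply/eqP; field.
  by rewrite !gt_eqF//= (_ : _ - _ = (1 - p) * (b * p)) ?mulr_gt0//; ring.
rewrite (gnp_exp_card_reachS p (fun k => potential b p ((1 - p) ^+ k)) mn).
rewrite exprS -mulrA.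
apply: (@le_trans _ _ (gnp_exp p (fun G : graph n =>
    (1 - p / (1 + b)) * potential b p ((1 - p) ^+ #|reach G m|)))).
  apply: gnp_exp_le => // G; rewrite exprS; apply: potential_step => //.
  rewrite exprn_ge0 ?(ltW q0)//=.
  rewrite -[leRHS]expr1 ler_wiXn2l ?(ltW q0)//; first by rewrite lerBlDr lerDl ltW.
  by apply: card_reach_gt0; apply: leq_ltn_trans mn.
rewrite gnp_expZ; apply: ler_wpM2l; last exact/IH/ltnW.
by rewrite subr_ge0 ler_pdivrMr; nra.
Qed.

(** The denominator of the potential is at most 1, so the potential dominates y,
    whose expectation is the probability that there is no path. *)
Lemma gnp_prob_no_path_le (R : realType) (m : nat) (b p : R) :
  0 < p < 1 -> 0 < b -> b * p < 1 ->
  gnp_prob p [set G : graph m.+2 | ~ has_monotone_path G]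
  <= (1 - p / (1 + b)) ^+ m / (b * p).
Proof.
move=> p01 b0 bp; rewrite gnp_prob_no_path; have /andP[p0 p1] := p01.
have q0 : 0 < 1 - p by rewrite subr_gt0.
apply: le_trans (gnp_exp_potential_le p01 b0 bp (ltnW (ltnSn m.+1))).
apply: gnp_exp_le => [|G]; first by rewrite !ltW.
set y := _ ^+ _.
have y0 : 0 < y by apply: exprn_gt0.
have yq : y <= 1 - p.
  rewrite -[leRHS]expr1 ler_wiXn2l ?(ltW q0)//; first by rewrite lerBlDr lerDl ltW.
  exact: card_reach_gt0.
have bp0 : 0 < b * p by rewrite mulr_gt0.
have zq : (1 - b * p) * y <= (1 - b * p) * (1 - p).
  by apply: ler_wpM2l => //; lra.
have z0 : 0 <= (1 - b * p) * y by rewrite mulr_ge0 ?(ltW y0)//; lra.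
have d0 : 0 < 1 - p - (1 - b * p) * y by have := mulr_gt0 bp0 q0; lra.
by rewrite /potential ler_pdivlMr// ler_piMr ?(ltW y0)//; lra.
Qed.

(** * Asymptotics in ln n *)

Lemma near_ln_nat_ge (R : realType) (M : R) :
  \forall n \near \oo, M <= ln (n%:R : R).
Proof.
near=> n.
have Mn : expR M <= n%:R.
  near: n; have /cvgryPge := @cvgr_idn R; exact.
rewrite -(expRK M) ler_ln ?posrE ?expR_gt0//.
by apply: lt_le_trans Mn; exact: expR_gt0.
Unshelve. all: by end_near. Qed.

Lemma whp_of_le (R : realType) (p : nat -> R) (A : forall n, set (graph n))
    (C : R) :
  (\forall n \near \oo, 0 <= p n <= 1) ->
  (\forall n \near \oo, gnp_prob (p n) (~` A n) <= C / ln (n%:R : R)) ->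
  whp p A.
Proof.
move=> p01 PC; have ln_oo : ln (n%:R : R) @[n --> \oo] --> +oo.
  by apply/cvgryPge => M; exact: near_ln_nat_ge.
have C0 : C / ln (n%:R : R) @[n --> \oo] --> (0 : R).
  rewrite -(mulr0 C); apply: cvgMr.
  by apply/gtr0_cvgV0 => //; near=> n; apply: lt_le_trans ltr01 _; near: n;
     exact: near_ln_nat_ge.
apply: (@squeeze_cvgr _ _ _ _ (fun n => 1 - C / ln (n%:R : R)) (fun=> 1)).
- near=> n; have p01n : 0 <= p n <= 1 by near: n.
  have PCn : gnp_prob (p n) (~` A n) <= C / ln (n%:R : R) by near: n.
  have P0 : 0 <= gnp_prob (p n) (~` A n).
    by apply: sumr_ge0 => G _; exact: gnp_weight_ge0.
  by move: PCn P0; rewrite gnp_probC; lra.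
- by rewrite -[X in _ --> X]subr0; apply: cvgB => //; exact: cvg_cst.
- exact: cvg_cst.
Unshelve. all: by end_near. Qed.

(** From exp t >= 1 + t ^ 2 / 2 at t = a x. With x = ln n it bounds both
    ln n / n (a = 1) and ln n * n ^ (- eps) (a = eps) by a multiple of 1 / ln n. *)
Lemma mulr_expRN_le (R : realType) (a x : R) : 0 < a -> 0 < x ->
  x * expR (- (a * x)) <= 2 / a ^+ 2 / x.
Proof.
move=> a0 x0; rewrite expRN ler_pdivrMr ?expR_gt0//.
have := @expR_ge1Dxn R (a * x) 1 (ltW (mulr_gt0 a0 x0)).
rewrite -(ler_pM2l (_ : 0 < 2 / a ^+ 2 / x)); last by rewrite !divr_gt0 ?exprn_gt0.
apply: le_trans; rewrite exprMn.
rewrite mulrDr mulr1.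
have -> : 2 / a ^+ 2 / x * (a ^+ 2 * x ^+ 2 / 2`!%:R) = x.
  by rewrite (_ : 2`! = 2)//; field; rewrite !gt_eqF.
by rewrite lerDr !divr_ge0 ?exprn_ge0 ?ltW.
Qed.

Lemma ln_div_natE (R : realType) (n : nat) : (0 < n)%N ->
  ln (n%:R : R) / n%:R = ln (n%:R : R) * expR (- ln (n%:R : R)).
Proof. by move=> n0; rewrite expRN lnK// posrE ltr0n. Qed.

Lemma ln_div_nat_le (R : realType) (n : nat) (M : R) : (0 < n)%N ->
  0 < M -> 2 * M <= ln (n%:R : R) -> ln (n%:R : R) / n%:R <= M^-1.
Proof.
move=> n0 M0 Mn; have L0 : 0 < ln (n%:R : R) by apply: lt_le_trans Mn; lra.
rewrite ln_div_natE//; apply: le_trans (_ : 2 / ln (n%:R : R) <= _).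
  have := mulr_expRN_le (@ltr01 R) L0.
  by rewrite mul1r expr1n divr1.
by rewrite ler_pdivrMr// mulrC ler_pdivlMr.
Qed.

(** As 1 + p <= exp p, the left-hand side is at most p * exp (p n), that is
    (1 - eps) * ln n * n ^ (- eps). *)
Lemma subcritical_bound (R : realType) (n m : nat) (eps p : R) : n = m.+2 ->
  0 < eps < 1 -> 0 < ln (n%:R : R) -> p = (1 - eps) * (ln n%:R / n%:R) ->
  p * (1 + p) ^+ m <= 2 / eps ^+ 2 / ln (n%:R : R).
Proof.
move=> nm /andP[e0 e1] L0 pE; have n0 : (0 < n)%N by rewrite nm.
have nR0 : 0 < n%:R :> R by rewrite ltr0n.
have p0 : 0 <= p by rewrite pE mulr_ge0 ?divr_ge0// ?ltW// subr_gt0.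
apply: le_trans (mulr_expRN_le e0 L0).
apply: (@le_trans _ _ (p * expR (p * n%:R))).
  apply: ler_wpM2l => //; apply: (@le_trans _ _ (expR p ^+ m)).
    by apply: lerXn2r; rewrite ?nnegrE ?addr_ge0 ?expR_ge0 ?expR_ge1Dx.
  rewrite -expRM_natl ler_expR mulrC; apply: ler_wpM2l => //.
  by rewrite ler_nat nm !leqW.
have -> : p * n%:R = (1 - eps) * ln (n%:R : R).
  by rewrite pE -mulrA divfK ?gt_eqF.
rewrite mulrBl mul1r expRD mulrA; apply: ler_wpM2r; first exact: expR_ge0.
rewrite lnK ?posrE// pE -mulrA divfK ?gt_eqF//.
by rewrite ler_piMl ?(ltW L0)//; lra.
Qed.

(** The base is 1 - ln n / n, whose (n - 2)-th power is at most exp 2 / n: the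
    exponent n - 2 instead of n costs the factor exp (2 ln n / n) <= exp 2. *)
Lemma supercritical_bound (R : realType) (n m : nat) (eps p : R) : n = m.+2 ->
  0 < eps -> 2 <= ln (n%:R : R) -> p = (1 + eps) * (ln n%:R / n%:R) ->
  (1 - p / (1 + eps)) ^+ m / (eps * p)
  <= expR 2 / (eps * (1 + eps)) / ln (n%:R : R).
Proof.
move=> nm e0 L2 pE; have n0 : (0 < n)%N by rewrite nm.
set L := ln _ in L2 pE *; set t := L / n%:R in pE.
have L0 : 0 < L by apply: lt_le_trans L2.
have nR0 : 0 < n%:R :> R by rewrite ltr0n.
have t0 : 0 < t by rewrite divr_gt0.
have e1 : 0 < 1 + eps by rewrite addr_gt0.
have t1 : t <= 1 by rewrite -[leRHS]invr1; apply: ln_div_nat_le => //; rewrite mulr1.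
have p0 : 0 < p by rewrite pE mulr_gt0.
have -> : p / (1 + eps) = t by rewrite pE mulrAC divff ?mul1r ?gt_eqF.
have pow_le : (1 - t) ^+ m <= expR 2 * expR (- L).
  apply: (@le_trans _ _ (expR (- t) ^+ m)).
    by apply: lerXn2r; rewrite ?nnegrE ?subr_ge0 ?expR_ge0 ?expR_ge1Dx.
  rewrite -expRM_natl -expRD ler_expR.
  have tn : t * n%:R = L by rewrite /t divfK ?gt_eqF.
  by move: tn; rewrite nm -addn2 natrD; lra.
rewrite ler_pdivrMr ?mulr_gt0//; apply: (le_trans pow_le).
rewrite le_eqVlt; apply/orP; left; apply/eqP.
by rewrite pE /t ln_div_natE// -/L; field; rewrite !gt_eqF.
Qed.

Theorem theorem25 (R : realType) :
  (forall eps : R, 0 < eps < 1 ->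
     whp (fun n => (1 - eps) * (ln n%:R / n%:R))
         (fun n => [set G : graph n | ~ has_monotone_path G]))
  /\
  (forall eps : R, 0 < eps ->
     whp (fun n => (1 + eps) * (ln n%:R / n%:R))
         (fun n => [set G : graph n | has_monotone_path G])).
Proof.
have near2 : \forall n \near \oo, exists m, n = m.+2.
  by exists 2%N => // -[|[|m]] //= _; exists m.
have nearL := @near_ln_nat_ge R.
split=> eps.
- move=> eps01; have /andP[e0 e1] := eps01.
  have p01 n (m : nat) : n = m.+2 -> 2 <= ln (n%:R : R) ->
      0 <= (1 - eps) * (ln n%:R / n%:R) <= 1.
    move=> nm L2; have n0 : (0 < n)%N by rewrite nm.
    have L0 : 0 <= ln (n%:R : R) / n%:R by rewrite divr_ge0 ?(le_trans _ L2).
    have L1 : ln (n%:R : R) / n%:R <= 1.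
      by rewrite -[leRHS]invr1; apply: ln_div_nat_le => //; rewrite mulr1.
    rewrite mulr_ge0//=; last by lra.
    by apply: mulr_ile1 => //; lra.
  apply: (@whp_of_le _ _ _ (2 / eps ^+ 2)).
    by apply: filterS2 near2 (nearL 2) => n [m]; exact: p01.
  apply: filterS2 near2 (nearL 2) => n [m nm] L2.
  rewrite -[X in gnp_prob _ (~` X)]/(~` _) setCK.
  apply: le_trans (subcritical_bound nm eps01 (lt_le_trans _ L2) erefl) => //.
  by move: (p01 n m nm L2); rewrite nm; exact: gnp_prob_path_le.
- move=> e0; have e1 : 0 < 1 + eps by rewrite addr_gt0.
  (* (1 + eps) p = M ln n / n, and (1 + eps) p < 1 gives both p < 1 and
     eps p < 1. *)
  pose M := (1 + eps) * (1 + eps).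
  have M1 : 1 < M by rewrite /M; nra.
  have M0 : 0 < M by apply: lt_trans M1.
  have p_cond n (m : nat) : n = m.+2 -> 2 * M + 2 <= ln (n%:R : R) ->
      let p := (1 + eps) * (ln n%:R / n%:R) in 0 < p < 1 /\ eps * p < 1.
    move=> nm LM p; have n0 : (0 < n)%N by rewrite nm.
    have L0 : 0 < ln (n%:R : R) by apply: lt_le_trans LM; lra.
    have p0 : 0 < p by rewrite mulr_gt0 ?divr_gt0 ?ltr0n.
    suff : (1 + eps) * p < 1 by have := mulr_gt0 e0 p0; split; lra.
    have tM : ln (n%:R : R) / n%:R <= (M + 1)^-1.
      by apply: ln_div_nat_le => //; lra.
    rewrite /p mulrA -/M; apply: (@le_lt_trans _ _ (M / (M + 1))).
      by apply: ler_wpM2l => //; exact: ltW.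
    by rewrite ltr_pdivrMr; lra.
  apply: (@whp_of_le _ _ _ (expR 2 / (eps * (1 + eps)))).
    apply: filterS2 near2 (nearL (2 * M + 2)) => n [m nm] /(p_cond n m nm)[].
    by case/andP=> p0 p1 _; rewrite !ltW.
  apply: filterS2 near2 (nearL (2 * M + 2)) => n [m nm] LM.
  apply: le_trans (supercritical_bound nm e0 _ erefl); last by lra.
  have [] := p_cond n m nm LM; rewrite {}nm => p01 ep.
  exact: gnp_prob_no_path_le.
Qed.
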